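(* Let $\phi:[c]^v\to\mathbb R$ be an arbitrary function, let $\beta\in\mathbb R$, and let $\{Q_n\}_{n\ge1}$ be a sequence of symmetric, zero-diagonal $v$-tensors such that $\|W_{Q_n}-W_\infty\|_{\square^*}\to0$ as $n\to\infty$, for some $W_\infty\in\mathcal W_v$. Consider the optimization problem $$\sup_{\boldsymbol f\in\mathcal F_c}\left\{\beta\, G_{W_\infty,\phi}(\boldsymbol f)-\int_0^1\sum_{r=1}^c f_r(u)\log\frac{f_r(u)}{\mu_r}\,du\right\}.\qquad(\ast)$$ (i) (Characterization of optimizers) If $\boldsymbol f=(f_1,\ldots,f_c)$ is a maximizer of $(\ast)$, then for every $r\in[c]$ and Lebesgue-almost every $x\in[0,1]$, $$f_r(x)=\frac{\mu_r\exp\big(\beta\,\mathcal T_r[W_\infty,\phi,\boldsymbol f](x)\big)}{\sum_{s=1}^c\mu_s\exp\big(\beta\,\mathcal T_s[W_\infty,\phi,\boldsymbol f](x)\big)}.$$ (ii) (Replica symmetry breaking) Suppose there exist $r,s\in[c]$ such that $\Gamma_r((\mu_1,\ldots,\mu_c))\ne\Gamma_s((\mu_1,\ldots,\mu_c))$. Assume moreover that $\beta\neq0$ and that $\mathcal V[W_\infty](\cdot)$ is not Lebesgue-a.e. constant. Then none of the maximizers of $(\ast)$ are Lebesgue-a.e. constant.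
   Context: Integers $c,v\ge2$ are fixed, $[m]:=\{1,\ldots,m\}$, and $\mu$ is a probability measure on $[c]$ with $\mu_r:=\mu(\{r\})>0$ for all $r\in[c]$. A $v$-tensor $Q_n:[n]^v\to\mathbb R$ is symmetric if it is invariant under permutations of its arguments, and zero-diagonal if $Q_n(i_1,\ldots,i_v)=0$ whenever $i_1,\ldots,i_v$ are not all distinct. $\mathcal W_v$ is the space of symmetric real-valued functions in $L^1([0,1]^v)$; $W_{Q_n}\in\mathcal W_v$ is defined by $W_{Q_n}(x_1,\ldots,x_v):=Q_n(i_1,\ldots,i_v)$ if $\max\{\lceil nx_r\rceil,1\}=i_r$ for all $r\in[v]$. For $W\in\mathcal W_v$, $\|W\|_{\square^*}:=\sup_{S\subseteq[0,1]}\left|\int_{S^v}W\prod_i dx_i\right|$ (measurable $S$). $\mathcal F_c$ is the set of measurable $\boldsymbol f=(f_1,\ldots,f_c):[0,1]\to[0,1]^c$ with $\sum_{r=1}^c f_r(x)=1$ for all $x$ (modulo a.e. equality), and $$G_{W,\phi}(\boldsymbol f):=\int_{[0,1]^v}W(x_1,\ldots,x_v)\sum_{r_1,\ldots,r_v\in[c]}\phi(r_1,\ldots,r_v)\prod_{a=1}^v f_{r_a}(x_a)\,dx_1\cdots dx_v.$$ For $m\in[v]$, $r\in[c]$, $$\mathcal T_r^{(m)}[W,\phi,\boldsymbol f](x):=\int_{[0,1]^{v-1}}W(x_1,\ldots,x_{m-1},x,x_{m+1},\ldots,x_v)\sum_{s_1,\ldots,s_{m-1},s_{m+1},\ldots,s_v\in[c]}\phi(s_1,\ldots,s_{m-1},r,s_{m+1},\ldots,s_v)\prod_{a\ne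 m}f_{s_a}(x_a)\prod_{a\neq m}dx_a,$$ and $\mathcal T_r[W,\phi,\boldsymbol f](x):=\sum_{m=1}^v\mathcal T_r^{(m)}[W,\phi,\boldsymbol f](x)$. For $\boldsymbol y\in\mathbb R^c$, $$\Gamma_r(\boldsymbol y):=\sum_{m=1}^v\ \sum_{s_1,\ldots,s_{m-1},s_{m+1},\ldots,s_v\in[c]}\phi(s_1,\ldots,s_{m-1},r,s_{m+1},\ldots,s_v)\prod_{a\neq m}y_{s_a},$$ and $\mathcal V[W](x):=\int_{[0,1]^{v-1}}W(x,x_2,\ldots,x_v)\prod_{a=2}^v dx_a$. Convention: $0\log0=0$. *)

(* Defs.v *)
From HB Require Import structures.
From mathcomp Require Import all_boot all_order all_algebra all_fingroup.
From mathcomp Require Import all_classical all_reals all_analysis.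
Set Implicit Arguments.
Unset Strict Implicit.
Unset Printing Implicit Defensive.
Import Order.TTheory GRing.Theory Num.Theory.
Import numFieldNormedType.Exports.
Local Open Scope classical_set_scope.
Local Open Scope ring_scope.

(* The library only has binary product measures: the n-fold product is built
   by transporting m1 \x (n-fold product) along (x, t) |-> x :: t. *)
Section tuple_measure.
Context d (T : measurableType d) (R : realType).
Variable m1 : {sigma_finite_measure set T -> \bar R}.

Definition tuple_cons n (p : T * n.-tuple T) : n.+1.-tuple T :=
  [tuple of p.1 :: p.2].

Lemma measurable_tuple_cons n :
  measurable_fun [set: T * n.-tuple T] (@tuple_cons n).
Proof. exact: measurable_cons. Qed.

Section cons.
Variables (n : nat) (m : {sigma_finite_measure set (n.-tuple T) -> \bar R}).

Definition tuple_measure_cons : set (n.+1.-tuple T) -> \bar R :=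
  pushforward (m1 \x m)%E (@tuple_cons n).

Let tm0 : tuple_measure_cons set0 = 0%E.
Proof. by rewrite /tuple_measure_cons /pushforward preimage_set0 measure0. Qed.

Let tm_ge0 A : (0 <= tuple_measure_cons A)%E.
Proof. exact: (measure_ge0 (m1 \x m)%E). Qed.

Let tm_sigma_additive : semi_sigma_additive tuple_measure_cons.
Proof.
move=> F mF tF mUF; rewrite /tuple_measure_cons /pushforward preimage_bigcup.
have mcons B : measurable B -> measurable (@tuple_cons n @^-1` B).
  by move=> mB; rewrite -[X in measurable X]setTI; exact: measurable_tuple_cons.
apply: measure_semi_sigma_additive.
- by move=> k; exact: mcons.
- apply/trivIsetP => /= i j _ _ ij; rewrite -preimage_setI.
  by move/trivIsetP : tF => /(_ _ _ _ _ ij) ->//; rewrite preimage_set0.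
- by rewrite -preimage_bigcup; exact: mcons.
Qed.

HB.instance Definition _ := isMeasure.Build _ _ _ tuple_measure_cons
  tm0 tm_ge0 tm_sigma_additive.

Let tm_sigma_finite : sigma_finite setT tuple_measure_cons.
Proof.
have /sigma_finiteP[F [TF ndF Foo]] := sigma_finiteT m1.
have /sigma_finiteP[G [TG ndG Goo]] := sigma_finiteT m.
pose H k : set (n.+1.-tuple T) :=
  [set t | F k (tnth t ord0) /\ G k [tuple of behead t]].
have HE k : @tuple_cons n @^-1` H k = F k `*` G k.
  have bK (x : T) (t : n.-tuple T) :
    [tuple of behead (tuple_cons (x, t))] = t by exact/val_inj.
  by apply/seteqP; split=> -[x t]; rewrite /H /= bK.
exists H.
  apply/seteqP; split=> // t _.
  have [i _ Fi] : (\bigcup_i F i) (tnth t ord0) by rewrite -TF.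
  have [j _ Gj] : (\bigcup_i G i) [tuple of behead t] by rewrite -TG.
  exists (maxn i j) => //; split.
  - by move: Fi; apply/subsetPset/ndF/leq_maxl.
  - by move: Gj; apply/subsetPset/ndG/leq_maxr.
move=> k; have [mF Fk] := Foo k; have [mG Gk] := Goo k; split.
  apply: measurableI.
    rewrite -[X in measurable X]setTI.
    exact: (measurable_tnth ord0 measurableT mF).
  rewrite -[X in measurable X]setTI.
  exact: (measurable_behead measurableT mG).
rewrite /tuple_measure_cons /pushforward HE.
by rewrite product_measure1E// lte_mul_pinfty// ge0_fin_numE.
Qed.

HB.instance Definition _ := Measure_isSigmaFinite.Build _ _ _ tuple_measure_cons
  tm_sigma_finite.

End cons.

Fixpoint tuple_measure n : {sigma_finite_measure set (n.-tuple T) -> \bar R} :=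
  if n is k.+1 then tuple_measure_cons (tuple_measure k) 
  else \d_ [tuple].
End tuple_measure.

Lemma tuple_measureE d (T : measurableType d) (R : realType)
    (m1 : {sigma_finite_measure set T -> \bar R}) n (A : 'I_n -> set T) :
  (forall i, measurable (A i)) ->
  tuple_measure m1 n [set t | forall i, A i (tnth t i)] =
  (\prod_(i < n) m1 (A i))%E.
Proof.
elim: n A => [|n IH] A mA.
  rewrite big_ord0 /= diracE mem_set//; by case.
rewrite big_ord_recl -IH// -product_measure1E//; last first.
  rewrite (_ : [set _ | _] = \bigcap_(i in [set: 'I_n])
     ((@tnth n T)^~ i @^-1` A (lift ord0 i))); last first.
    by apply/seteqP; split=> t /= h i => [_|]; exact: h.
  apply: fin_bigcap_measurable => // i _.
  rewrite -[X in measurable X]setTI.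
  exact: (measurable_tnth i measurableT (mA _)).
congr (product_measure1 _ _ _).
apply/seteqP; split=> -[x t] /=.
  move=> h; split; first exact: (h ord0).
  by move=> i; have := h (lift ord0 i); rewrite /tuple_cons tnthS.
move=> [h0 h] i; case: (unliftP ord0 i) => [j ->|-> //].
by rewrite /tuple_cons tnthS; exact: h.
Qed.

Section symmetric_functions.
Context {R : realType}.

Definition lebesgue_tuple n :
    {sigma_finite_measure set (n.-tuple (measurableTypeR R)) -> \bar R} :=
  tuple_measure (@lebesgue_measure R) n.

Definition set_power n (S : set R) : set (n.-tuple R) :=
  [set x | forall i, S (tnth x i)].
Arguments set_power n S : clear implicits.

Definition cube n : set (n.-tuple R) := set_power n `[0, 1].
Arguments cube n : clear implicits.

(* An element of the space is a class modulo a.e. equality, of which W is a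
   representative; accordingly the symmetry is required a.e. only. *)
Definition symmetric_L1 v (W : v.-tuple R -> R) : Prop :=
  (lebesgue_tuple v).-integrable (cube v) (EFin \o W) /\
  forall s : 'S_v, \forall x \ae lebesgue_tuple v, cube v x ->
    W [tuple tnth x (s i) | i < v] = W x.

Definition cut_norm_star v (W : v.-tuple R -> R) : \bar R :=
  ereal_sup [set `|\int[lebesgue_tuple v]_(x in set_power v S) (W x)%:E|%E |
             S in [set S : set R | measurable S /\ S `<=` `[0, 1]]].

(* 'I_n is [n] shifted by one. *)
Definition symmetric_tensor n v (Q : v.-tuple 'I_n -> R) : Prop :=
  forall (s : 'S_v) (i : v.-tuple 'I_n), Q [tuple tnth i (s a) | a < v] = Q i.

Definition zero_diagonal n v (Q : v.-tuple 'I_n -> R) : Prop :=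
  forall i : v.-tuple 'I_n, ~~ uniq i -> Q i = 0.

(* For x in the cube and 0 < n, exactly one i satisfies the condition. *)
Definition tensor_kernel n v (Q : v.-tuple 'I_n -> R) (x : v.-tuple R) : R :=
  \sum_(i : v.-tuple 'I_n |
    [forall r, Num.max (Num.ceil (n%:R * tnth x r)) 1 == (tnth i r).+1%:Z])
  Q i.

Lemma tensor_kernelE n v (Q : v.-tuple 'I_n -> R) (x : v.-tuple R)
    (i : v.-tuple 'I_n) :
  (forall r, Num.max (Num.ceil (n%:R * tnth x r)) 1 = (tnth i r).+1%:Z) ->
  tensor_kernel Q x = Q i.
Proof.
move=> xi; rewrite /tensor_kernel (big_pred1 i)// => j /=.
apply/forallP/eqP => [xj|-> r]; last exact/eqP.
apply/eq_from_tnth => r; apply/val_inj.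
by have /eqP := xj r; rewrite xi => -[].
Qed.

End symmetric_functions.
Arguments set_power {R} n S.
Arguments cube {R} n.

(* The v-tuple with x in position m (counted from 0), and the entries of y in
   the other positions. *)
Definition insert_at (T : Type) v (m : nat) (x : T) (y : v.-1.-tuple T) :
    v.-tuple T :=
  [tuple if (i : nat) == m then x else nth x y (unbump m i) | i < v].

Lemma tnth_insert_at (T : Type) v (m : 'I_v) (x : T) (y : v.-1.-tuple T) :
  tnth (insert_at m x y) m = x.
Proof. by rewrite tnth_mktuple eqxx. Qed.

Lemma tnth_insert_at_lift (T : Type) v (m : 'I_v) (x : T) (y : v.-1.-tuple T) j :
  tnth (insert_at m x y) (lift m j) = tnth y j.
Proof.
by rewrite tnth_mktuple /= eq_sym (negbTE (neq_bump m j)) bumpK (tnth_nth x).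
Qed.

Section mean_field.
Context {R : realType} (c v : nat).
Implicit Types (W : v.-tuple R -> R) (phi : v.-tuple 'I_c -> R).
Implicit Types (mu : 'I_c -> R) (f : 'I_c -> R -> R) (r : 'I_c).

Definition fractional_partition f : Prop :=
  [/\ forall r, measurable_fun (`[0, 1] : set R) (f r),
      forall r x, x \in `[0, 1] -> 0 <= f r x <= 1 &
      forall x, x \in `[0, 1] -> \sum_(r < c) f r x = 1].

Definition G W phi f : R :=
  \int[lebesgue_tuple v]_(x in cube v)
    (W x * \sum_(r : v.-tuple 'I_c)
             phi r * \prod_(a < v) f (tnth r a) (tnth x a)).

Definition T_pos W phi f (m : 'I_v) r (x : R) : R :=
  \int[lebesgue_tuple v.-1]_(y in cube v.-1)
    (W (insert_at m x y) *
     \sum_(s : v.-1.-tuple 'I_c)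
        phi (insert_at m r s) * \prod_(a < v.-1) f (tnth s a) (tnth y a)).

Definition T_sum W phi f r (x : R) : R := \sum_(m < v) T_pos W phi f m r x.

Definition Gamma phi r (y : 'I_c -> R) : R :=
  \sum_(m < v) \sum_(s : v.-1.-tuple 'I_c)
    phi (insert_at m r s) * \prod_(a < v.-1) y (tnth s a).

Definition degree W (x : R) : R :=
  \int[lebesgue_tuple v.-1]_(y in cube v.-1) W (insert_at 0 x y).

(* ln 0 = 0 in the library, so that 0 log 0 = 0. *)
Definition rel_entropy mu f : R :=
  \int[lebesgue_measure]_(u in `[0, 1]) \sum_(r < c) f r u * ln (f r u / mu r).

Definition free_energy mu phi (beta : R) W f : R :=
  beta * G W phi f - rel_entropy mu f.

Definition is_maximizer mu phi beta W f : Prop :=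
  fractional_partition f /\
  forall g, fractional_partition g ->
    free_energy mu phi beta W g <= free_energy mu phi beta W f.

End mean_field.

Definition ae_constant (R : realType) (A : Type) (h : R -> A) : Prop :=
  exists y : A, \forall x \ae (@lebesgue_measure R), x \in `[0, 1] -> h x = y.

(* Main.v *)
Require Import Defs.
From mathcomp Require Import all_boot all_order all_algebra all_fingroup.
From mathcomp Require Import all_classical all_reals all_analysis.
From mathcomp Require Import measurable_realfun ring lra.
Import Order.TTheory GRing.Theory Num.Theory.
Import numFieldNormedType.Exports.
Local Open Scope classical_set_scope.
Local Open Scope ring_scope.
Set Implicit Arguments.
Unset Strict Implicit.
Unset Printing Implicit Defensive.

(* Let f be a maximizer, h the Gibbs density on the right-hand side of (i), and
   f_t = (1 - t) f + t h. As G is multilinear in f,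
     G(f_t) = G(f) + t \sum_r \int (h_r - f_r) T_r + O(t^2),
   while convexity of the relative entropy H gives
     H(f_t) <= H(f) + t (H(h) - H(f));
   the entropy, which has an infinite slope where some f_r vanishes, is never
   differentiated. Letting t -> 0 in the maximality of f,
     beta \sum_r \int (h_r - f_r) T_r <= H(h) - H(f).
   Since beta T_r = ln (h_r / mu_r) + ln Z with Z the normalizing constant, this
   says that the integral of the Kullback-Leibler divergence of f(x) from h(x)
   is nonpositive, whence f = h a.e.
   If f is a.e. equal to a constant p, then T_r(x) = V(x) Gamma_r(p) a.e., so
   V(x) (Gamma_r(p) - Gamma_s(p)) is a.e. constant by (i). As V is not, all the
   Gamma_r(p) agree; (i) then gives p = mu, a contradiction. *)

(** * Fubini for iterated product measures *)

Section tuple_fubini.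
Context d (T : measurableType d) (R : realType).
Variable m1 : {sigma_finite_measure set T -> \bar R}.

Definition box n (A : 'I_n -> set T) : set (n.-tuple T) :=
  [set t | forall i, A i (tnth t i)].

Lemma measurable_box n (A : 'I_n -> set T) :
  (forall i, measurable (A i)) -> measurable (box A).
Proof.
move=> mA; rewrite (_ : box A =
    \bigcap_(i in [set: 'I_n]) ((@tnth n T)^~ i @^-1` A i)).
  apply: fin_bigcap_measurable => // i _.
  rewrite -[X in measurable X]setTI.
  exact: (measurable_tnth i measurableT (mA _)).
by apply/seteqP; split=> t /= h i => [_|]; exact: h.
Qed.

(** The uncurried form of [insert_at] is a map on the product space, along which the product measure
    can be pushed forward. *)
Definition insert n (m : 'I_n.+1) (p : T * n.-tuple T) : n.+1.-tuple T :=
  @insert_at T n.+1 m p.1 p.2.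

Lemma tnth_insert n (m : 'I_n.+1) p : tnth (insert m p) m = p.1.
Proof. exact: tnth_insert_at. Qed.

Lemma tnth_insert_lift n (m : 'I_n.+1) p j :
  tnth (insert m p) (lift m j) = tnth p.2 j.
Proof. exact: (@tnth_insert_at_lift _ n.+1). Qed.

Lemma measurable_insert n (m : 'I_n.+1) : measurable_fun setT (@insert n m).
Proof.
apply/measurable_fun_tnthP => i; case: (unliftP m i) => [j ->|->].
  rewrite (_ : _ \o _ = (@tnth n T)^~ j \o snd).
    by apply: measurableT_comp => //; exact: measurable_tnth.
  by apply/funext => p /=; rewrite tnth_insert_lift.
rewrite (_ : _ \o _ = fst)//.
by apply/funext => p /=; rewrite tnth_insert.
Qed.

Lemma preimage_insert_box n (m : 'I_n.+1) (A : 'I_n.+1 -> set T) :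
  insert m @^-1` box A = A m `*` box (fun j => A (lift m j)).
Proof.
apply/seteqP; split=> p /=.
  move=> h; split; first by have := h m; rewrite tnth_insert.
  by move=> j; have := h (lift m j); rewrite tnth_insert_lift.
move=> [hm hl] i; case: (unliftP m i) => [j ->|->].
  by rewrite tnth_insert_lift; exact: hl.
by rewrite tnth_insert.
Qed.

(** A coordinate cylinder is a box whose other sides are the whole space. Boxes are thus a
    generating family, stable under intersection, on which two measures can be compared. *)
Lemma box_measurableE n :
  @measurable _ (n.-tuple T) =
  <<s [set B | exists2 A : 'I_n -> set T,
         (forall i, measurable (A i)) & B = box A] >>.
Proof.
apply/seteqP; split.
  apply: smallest_sub; first exact: smallest_sigma_algebra.
  rewrite -bigcup_seq => B /= [i _ [A mA <-]]; apply: sub_sigma_algebra => /=.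
  exists (fun j => if j == i then A else setT).
    by move=> j; case: ifPn.
  rewrite setTI; apply/seteqP; split=> t /=.
    by move=> At j; case: ifPn => // /eqP ->.
  by move=> /(_ i); rewrite eqxx.
apply: smallest_sub; first exact: sigma_algebra_measurable.
by move=> _ [A mA ->]; exact: measurable_box.
Qed.

(** [tuple_measure] splits off the first coordinate by construction; this lets any coordinate [m]
    play that role. On a box both sides are the product of the measures of its sides, and uniqueness
    of measures does the rest. *)
Lemma tuple_measure_insert n (m : 'I_n.+1) (A : set (n.+1.-tuple T)) :
  measurable A ->
  tuple_measure m1 n.+1 A =
  pushforward (m1 \x tuple_measure m1 n)%E (insert m) A.
Proof.
have /sigma_finiteP[F [TF ndF Foo]] := sigma_finiteT m1.
have mi := measurable_insert m.
pose m2 : {measure set (n.+1.-tuple T) -> \bar R} :=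
  measure_function_pushforward__canonical__measure_function_Measure
    (m1 \x tuple_measure m1 n)%E mi.
apply: (@measure_unique _ R _ _ (fun k => box (fun _ : 'I_n.+1 => F k))
  (@box_measurableE n.+1) _ _ _ (tuple_measure m1 n.+1) m2).
- move=> _ _ [A1 mA1 ->] [A2 mA2 ->].
  exists (fun i => A1 i `&` A2 i); first by move=> i; exact: measurableI.
  apply/seteqP; split=> t /=; first by move=> [h1 h2] i; split.
  by move=> h; split => i; have [] := h i.
- by move=> k; exists (fun=> F k) => // i; exact: (Foo k).1.
- apply/seteqP; split=> // t _.
  have h i : exists k, F k (tnth t i).
    have [k _ Fk] : (\bigcup_k F k) (tnth t i) by rewrite -TF.
    by exists k.
  have [k hk] := choice h.
  (* The sets [F k] increase, so the largest of the finitely many indices serves all coordinates at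
     once. *)
  exists (\max_i k i)%N => // i /=.
  have /subsetPset := ndF _ _ (leq_bigmax (F := k) i); apply; exact: hk.
- move=> _ [B mB ->].
  transitivity (\prod_i m1 (B i))%E; first exact: tuple_measureE.
  rewrite /m2 /= /pushforward preimage_insert_box product_measure1E//; last first.
    exact: measurable_box.
  rewrite (bigD1_ord m)//=; congr (_ * _)%E.
  by apply/esym; exact: tuple_measureE.
- move=> k; rewrite [X in (X < _)%E](_ : _ = \prod_(i < n.+1) m1 (F k))%E; last first.
    by apply: (tuple_measureE m1 (A := fun=> F k)) => i; exact: (Foo k).1.
  rewrite -ge0_fin_numE; last by apply: prode_ge0 => i _; exact: measure_ge0.
  rewrite prode_fin_num// => i _.
  by rewrite ge0_fin_numE; [exact: (Foo k).2|exact: measure_ge0].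
Qed.

(** Change of variables along [insert m]. The nonnegative case comes first because, applied to the
    absolute value, it yields the integrability that the general case requires. *)
Lemma ge0_integral_tuple n (m : 'I_n.+1) (f : n.+1.-tuple T -> \bar R) :
  measurable_fun [set: n.+1.-tuple T] f -> (forall t, 0 <= f t)%E ->
  (\int[tuple_measure m1 n.+1]_t f t =
   \int[m1 \x tuple_measure m1 n]_p f (insert m p))%E.
Proof.
move=> mf f0; have mi := measurable_insert m.
have f0' : {in [set: n.+1.-tuple T], forall y, 0 <= f y}%E by [].
have e := ge0_integral_pushforward mi (m1 \x tuple_measure m1 n)%E
  measurableT mf f0'.
rewrite preimage_setT in e.
transitivity (\int[pushforward (m1 \x tuple_measure m1 n) (insert m)]_t f t)%E.
  apply: eq_measure_integral => A mA _; exact: tuple_measure_insert.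
exact: e.
Qed.

Lemma integrable_insert n (m : 'I_n.+1) (f : n.+1.-tuple T -> \bar R) :
  (tuple_measure m1 n.+1).-integrable setT f ->
  (m1 \x tuple_measure m1 n)%E.-integrable setT (f \o insert m).
Proof.
move=> /integrableP[mf foo]; have mi := measurable_insert m.
apply/integrableP; split; first exact: measurableT_comp.
have := @ge0_integral_tuple n m (abse \o f).
move=> <- //; first exact: measurableT_comp.
by move=> t; exact: abse_ge0.
Qed.

Lemma integral_insert n (m : 'I_n.+1) (f : n.+1.-tuple T -> \bar R) :
  (tuple_measure m1 n.+1).-integrable setT f ->
  (\int[tuple_measure m1 n.+1]_t f t =
   \int[m1 \x tuple_measure m1 n]_p f (insert m p))%E.
Proof.
move=> fi; have mi := measurable_insert m; have mf := measurable_int _ fi.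
have e := integral_pushforward mi mf (integrable_insert m fi) measurableT.
rewrite preimage_setT in e.
transitivity (\int[pushforward (m1 \x tuple_measure m1 n) (insert m)]_t f t)%E.
  apply: eq_measure_integral => A mA _; exact: tuple_measure_insert.
exact: e.
Qed.

Lemma ae_insert n (m : 'I_n.+1) (P : n.+1.-tuple T -> Prop) :
  (\forall t \ae tuple_measure m1 n.+1, P t) ->
  \forall p \ae (m1 \x tuple_measure m1 n)%E, P (insert m p).
Proof.
move=> [N [mN N0 sub]]; exists (insert m @^-1` N); split.
- by rewrite -[X in measurable X]setTI; exact: measurable_insert.
- by rewrite -N0 (tuple_measure_insert m).
- by move=> p /= nP; exact: sub.
Qed.

(** There are finitely many coordinates, so each can be treated alone. Once coordinate [i] is split
    off, its exceptional set is a null set times the whole space. *)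
Lemma ae_tuple_measure (P : T -> Prop) n :
  {ae m1, forall x, P x} ->
  {ae tuple_measure m1 n, forall t, forall i, P (tnth t i)}.
Proof.
case=> N [mN N0 sub].
suff h (i : 'I_n) : {ae tuple_measure m1 n, forall t, P (tnth t i)}.
  exact: filter_forall.
exists (@tnth n T ^~ i @^-1` N); split.
- by rewrite -[X in measurable X]setTI; exact: measurable_tnth.
- case: n i => [[]//|n] i; rewrite (tuple_measure_insert i); last first.
    by rewrite -[X in measurable X]setTI; exact: measurable_tnth.
  rewrite /pushforward (_ : _ @^-1` _ = N `*` setT); last first.
    by apply/seteqP; split=> p /=; rewrite tnth_insert// => -[].
  by rewrite product_measure1E// [X in (X * _)%E]N0 mul0e.
- by move=> t /= nP; exact: sub.
Qed.

End tuple_fubini.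

(** The measures of the sections of a null set integrate to 0 and are nonnegative, so almost every
    section is null. *)
Lemma ae_xsection d1 d2 (T1 : measurableType d1) (T2 : measurableType d2)
    (R : realType) (m1 : {sigma_finite_measure set T1 -> \bar R})
    (m2 : {sigma_finite_measure set T2 -> \bar R}) (P : T1 * T2 -> Prop) :
  {ae (m1 \x m2)%E, forall p, P p} ->
  {ae m1, forall x, {ae m2, forall y, P (x, y)}}.
Proof.
move=> [N [mN N0 sub]].
have mx := measurable_fun_xsection m2 mN.
have : (\int[m1]_x `|(m2 \o xsection N) x| = 0)%E.
  rewrite -N0; apply: eq_integral => x _; rewrite gee0_abs//.
move=> /(ae_eq_integral_abs m1 measurableT mx).
apply: filterS => x /(_ I) /= h.
exists (xsection N x); split => //; first exact: measurable_xsection.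
by move=> y /= nP; rewrite /xsection /= inE; exact: sub.
Qed.

(** * Fubini on the unit cube, with an arbitrary coordinate singled out *)

Section cube_fubini.
Context {R : realType}.
Local Notation leb := (@lebesgue_measure R).
Local Notation ltup := (@lebesgue_tuple R).

Lemma measurable_cube n : measurable (@cube R n : set (n.-tuple (measurableTypeR R))).
Proof.
apply: (@measurable_box _ (measurableTypeR R) n (fun=> `[0%R, 1%R]%classic)) => i.
exact: measurable_itv.
Qed.

Lemma cube_insert n (m : 'I_n.+1) (x : R) (y : n.-tuple R) :
  cube n.+1 (@insert_at R n.+1 m x y) <-> x \in `[0, 1] /\ cube n y.
Proof.
have h := @preimage_insert_box _ (measurableTypeR R) n m (fun=> `[0%R, 1%R]%classic).
have {}h : cube n.+1 (@insert_at R n.+1 m x y) = (x \in `[0, 1] /\ cube n y).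
  exact: (congr1 (fun A => A (x, y)) h).
by rewrite h.
Qed.

Variables (n : nat) (m : 'I_n.+1) (F : n.+1.-tuple R -> R).
Hypothesis iF : (ltup n.+1).-integrable (cube n.+1) (EFin \o F).

(** Extension by zero turns integrals over the cube into integrals over the whole space, where the
    product formulas apply. *)
Let F' := (EFin \o F) \_ (cube n.+1).

Let iF' : (leb \x ltup n)%E.-integrable setT (F' \o insert m).
Proof.
apply: (@integrable_insert _ (measurableTypeR R) R leb n m F').
exact/(integrable_mkcond _ (@measurable_cube n.+1)).
Qed.

Let F'E (x : R) : x \in `[0, 1] -> (fun y => F' (@insert_at R n.+1 m x y)) =
  (fun y => (F (@insert_at R n.+1 m x y))%:E) \_ (cube n).
Proof.
move=> xI; apply/funext => y; rewrite /F' !patchE.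
case: ifPn => [|h]; rewrite ?inE.
  by move=> /(@cube_insert n m x y)[_ h]; rewrite mem_set.
case: ifPn => //; rewrite inE => yc; move: h; rewrite notin_setE; case.
exact/(@cube_insert n m x y).
Qed.

Lemma ae_integrable_cube : \forall x \ae leb, x \in `[0, 1] ->
  (ltup n).-integrable (cube n) (fun y => (F (@insert_at R n.+1 m x y))%:E).
Proof.
have := ae_integrable1 iF'; apply: filterS => x /= h xI.
by apply/(integrable_mkcond _ (@measurable_cube n)); rewrite -F'E.
Qed.

Let u (x : R) := (\int[ltup n]_y F' (@insert_at R n.+1 m x y))%E.

Let iu : leb.-integrable `[0, 1] u.
Proof.
by apply: integrableS (integrable_fubini_F iF').
Qed.

Let fuE (x : R) : x \in `[0, 1] ->
  \int[ltup n]_(y in cube n) F (@insert_at R n.+1 m x y) = fine (u x).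
Proof.
by move=> xI; rewrite /Rintegral /u integral_mkcond; congr fine; rewrite (F'E xI).
Qed.

Lemma integrable_cube_section : leb.-integrable `[0, 1]
  (fun x => (\int[ltup n]_(y in cube n) F (@insert_at R n.+1 m x y))%:E).
Proof.
have h := @eq_integrable _ _ R leb `[0%R, 1%R]%classic (measurable_itv _)
  (EFin \o (fine \o u)).
apply: h.
  by move=> x; rewrite inE => xI; rewrite fuE.
apply: le_integrable iu => //.
  apply/measurable_EFinP; apply: measurableT_comp => //.
  exact: measurable_int iu.
(* [fine] sends infinite values to 0, so it never increases the absolute value. *)
by move=> x _ /=; case: (u x) => [r||] /=; rewrite ?lexx ?leey.
Qed.

Lemma integral_cube : \int[ltup n.+1]_(t in cube n.+1) F t =
  \int[leb]_(x in `[0, 1]) \int[ltup n]_(y in cube n) F (@insert_at R n.+1 m x y).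
Proof.
rewrite /Rintegral integral_mkcond; congr fine.
rewrite -/F' (@integral_insert _ (measurableTypeR R) R leb n m F'); last first.
  exact/(integrable_mkcond _ (@measurable_cube n.+1)).
rewrite -integral12_prod_meas1//.
transitivity (\int[leb]_(x in `[0%R, 1%R]) u x)%E.
  rewrite [RHS]integral_mkcond; apply: eq_integral => x _.
  rewrite patchE; case: ifPn => //; rewrite notin_setE => xI.
  rewrite /fubini_F integral0_eq// => y _ /=; rewrite /F' patchE ifN//.
  by rewrite notin_setE => /(@cube_insert n m x y)[].
apply: ae_eq_integral => //.
- exact: measurable_int iu.
- exact: measurable_int integrable_cube_section.
(* Being integrable, [u] is finite almost everywhere, and there [fine] loses nothing. *)
have := integrable_ae _ iu; move=> /(_ (measurable_itv _)).
apply: filterS => x /= h xI; rewrite -/(Rintegral _ _ _) fuE//.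
by rewrite fineK//; exact: h.
Qed.

End cube_fubini.

(** * Complements on integrals and sums *)

Section Rintegral_complements.
Context d (T : measurableType d) (R : realType).
Variables (mu : {measure set T -> \bar R}) (D : set T).
Hypothesis mD : measurable D.
Implicit Types f g : T -> R.

Lemma integrableM_bounded f g (M : R) :
  mu.-integrable D (EFin \o f) -> measurable_fun D g ->
  (forall x, D x -> `|g x| <= M) ->
  mu.-integrable D (EFin \o (fun x => f x * g x)).
Proof.
move=> fi mg gM; have mf : measurable_fun D f.
  by apply/measurable_EFinP; exact: measurable_int fi.
apply: (le_integrable mD _ _ (integrableZl mD M fi)).
  by apply/measurable_EFinP; exact: measurable_funM.
move=> x Dx /=; rewrite lee_fin !normrM mulrC.
by rewrite ler_wpM2r// (le_trans (gM _ Dx)) ?ler_norm.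
Qed.

Lemma integrable_sumr (I : Type) (s : seq I) (f : I -> T -> R) :
  (forall i, mu.-integrable D (EFin \o f i)) ->
  mu.-integrable D (EFin \o (fun x => \sum_(i <- s) f i x)).
Proof.
move=> fi; rewrite (_ : _ \o _ = fun x => (\sum_(i <- s) (f i x)%:E)%E).
  by apply: (integrable_sum mD) => i _; exact: fi.
by apply/funext => x /=; rewrite sumEFin.
Qed.

Lemma Rintegral_sum (I : Type) (s : seq I) (f : I -> T -> R) :
  (forall i, mu.-integrable D (EFin \o f i)) ->
  \int[mu]_(x in D) (\sum_(i <- s) f i x) =
  \sum_(i <- s) \int[mu]_(x in D) f i x.
Proof.
move=> fi; elim: s => [|i s IHs].
  by under eq_Rintegral do rewrite big_nil; rewrite big_nil Rintegral_cst// mul0r.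
under eq_Rintegral do rewrite big_cons.
by rewrite big_cons RintegralD// ?IHs//; exact: integrable_sumr.
Qed.

Lemma ae_eq_Rintegral f g : measurable_fun D f -> measurable_fun D g ->
  {ae mu, forall x, D x -> f x = g x} ->
  \int[mu]_(x in D) f x = \int[mu]_(x in D) g x.
Proof.
move=> mf mg fg; congr fine; apply: ae_eq_integral => //.
- exact/measurable_EFinP.
- exact/measurable_EFinP.
- by apply: filterS fg => x h Dx /=; rewrite h.
Qed.

(** Serves to pass from a nonpositive integrated divergence to a divergence that vanishes almost
    everywhere. *)
Lemma Rintegral_le0_ae_eq0 f : mu.-integrable D (EFin \o f) ->
  (forall x, D x -> 0 <= f x) -> \int[mu]_(x in D) f x <= 0 ->
  {ae mu, forall x, D x -> f x = 0}.
Proof.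
move=> fi f0 If.
have /(ae_eq_integral_abs mu mD) : measurable_fun D (EFin \o f).
  exact: measurable_int fi.
move=> [h _].
have : (\int[mu]_(x in D) `|(EFin \o f) x| = 0)%E.
  transitivity (\int[mu]_(x in D) (f x)%:E)%E.
    by apply: eq_integral => x /[!inE] Dx /=; rewrite ger0_norm// f0.
  apply/eqP; rewrite eq_le integral_ge0 ?andbT; last first.
    by move=> x Dx; rewrite lee_fin f0.
  by rewrite -(@fineK _ (integral _ _ _)) ?lee_fin//; exact: integrable_fin_num.
move=> /h; apply: filterS => x hx Dx.
by have [] := hx Dx.
Qed.

End Rintegral_complements.

(** First-order Taylor formula for a product, by induction on the number of factors. The error
    constant depends on [n] only, so the estimate can later be integrated against [W]. *)
Lemma prod_expansion (R : realFieldType) n (u w : 'I_n -> R) (t : R) :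
  (forall i, `|u i| <= 1) -> (forall i, `|w i| <= 1) ->
  (forall i, `|u i + t * w i| <= 1) ->
  `|\prod_i (u i + t * w i) - \prod_i u i -
    t * \sum_i w i * \prod_(j | j != i) u j| <= n%:R ^+ 2 * t ^+ 2.
Proof.
elim: n u w => [|n IHn] u w u1 w1 uw1.
  by rewrite !big_ord0 mulr0 subr0 subrr normr0 expr0n mul0r.
rewrite ![\prod_(i < n.+1) _]big_ord_recl big_ord_recl.
have p0 : \prod_(j < n.+1 | j != ord0) u j = \prod_(j < n) u (lift ord0 j).
  by rewrite big_mkcond big_ord_recl /= mul1r.
have pS i : \prod_(j < n.+1 | j != lift ord0 i) u j =
    u ord0 * \prod_(j < n | j != i) u (lift ord0 j).
  rewrite big_mkcond big_ord_recl /=; congr (_ * _).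
  by rewrite [RHS]big_mkcond; apply: eq_bigr => j _; rewrite (inj_eq lift_inj).
rewrite p0; under [\sum_i _]eq_bigr do rewrite pS mulrCA.
rewrite -mulr_sumr.
have := IHn (fun i => u (lift ord0 i)) (fun i => w (lift ord0 i))
  (fun i => u1 _) (fun i => w1 _) (fun i => uw1 _).
set P := \prod_i _; set Q := \prod_i _; set S := \sum_i _ => h.
have S1 : `|S| <= n%:R.
  rewrite (le_trans (ler_norm_sum _ _ _))//.
  rewrite -[leRHS](_ : \sum_(i < n) 1 = _); last by rewrite sumr_const card_ord.
  apply: ler_sum => i _; rewrite normrM mulr_ile1// normr_prod.
  by apply: prodr_ile1 => j; rewrite normr_ge0 u1.
(* The new remainder is the perturbed first factor times the old remainder, plus a term of size at
   most [n%:R * t ^+ 2]. The constant closes because $n^2 + n \le (n+1)^2$. *)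
have -> : (u ord0 + t * w ord0) * P - u ord0 * Q - t * (w ord0 * Q + u ord0 * S)
  = (u ord0 + t * w ord0) * (P - Q - t * S) + t ^+ 2 * (w ord0 * S) by ring.
rewrite (le_trans (ler_normD _ _))//.
rewrite (normrM (u ord0 + _)) (normrM (t ^+ 2)) (normrM (w ord0)).
rewrite (ger0_norm (sqr_ge0 t)).
have h1 : `|u ord0 + t * w ord0| * `|P - Q - t * S| <= n%:R ^+ 2 * t ^+ 2.
  by rewrite (le_trans _ h)// ler_piMl.
have h2 : t ^+ 2 * (`|w ord0| * `|S|) <= t ^+ 2 * n%:R.
  by rewrite ler_wpM2l ?sqr_ge0// (le_trans _ S1)// ler_piMl.
rewrite (le_trans (lerD h1 h2))// -natr1.
have h3 : 0 <= n%:R * t ^+ 2 by apply: mulr_ge0 => //; exact: sqr_ge0.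
have h4 : 0 <= t ^+ 2 by exact: sqr_ge0.
nra.
Qed.

Lemma sum_insert_at (V : nmodType) (I : finType) n (a : 'I_n.+1)
    (F : n.+1.-tuple I -> V) :
  \sum_(r : n.+1.-tuple I) F r =
  \sum_(i : I) \sum_(s : n.-tuple I) F (@insert_at I n.+1 a i s).
Proof.
rewrite pair_big /=.
rewrite (reindex (fun p : I * n.-tuple I => @insert_at I n.+1 a p.1 p.2))//=.
exists (fun r : n.+1.-tuple I => (tnth r a, [tuple tnth r (lift a j) | j < n])).
- move=> [i s] _ /=; congr (_, _); first exact: tnth_insert_at.
  by apply/eq_from_tnth => j; rewrite tnth_mktuple (@tnth_insert_at_lift _ n.+1).
- move=> r _ /=; apply/eq_from_tnth => j.
  case: (unliftP a j) => [k ->|->].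
    by rewrite (@tnth_insert_at_lift _ n.+1) tnth_mktuple.
  by rewrite tnth_insert_at.
Qed.

(** * Entropy *)

Section entropy.
Context {R : realType}.
Implicit Types x y m p q t : R.

(** The left-hand side is the tangent at [y] to the convex function $x \log x$. For positive [x] the
    inequality is $1 + \log z \le z$ at $z = y/x$. *)
Lemma xlnx_tangent x y : 0 <= x -> 0 < y -> x * ln y + x - y <= x * ln x.
Proof.
rewrite le_eqVlt => /predU1P[<- y0|x0 y0]; first by rewrite !mul0r; lra.
have : 1 + ln (y / x) <= y / x.
  by rewrite -[leRHS]lnK ?posrE ?divr_gt0// expR_ge1Dx.
rewrite ln_div ?posrE// -(ler_pM2r x0) divfK ?gt_eqF//.
by nra.
Qed.

(** Strict convexity: the tangent touches the graph only at [y], because $1 + \log z < z$ for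
    positive $z \ne 1$. *)
Lemma xlnx_tangent_eq x y : 0 <= x -> 0 < y -> x * ln y + x - y = x * ln x ->
  x = y.
Proof.
rewrite le_eqVlt => /predU1P[<- y0|x0 y0]; first by rewrite !mul0r; lra.
move=> e; apply/eqP; apply: contraT => xy.
have : 1 + ln (y / x) < y / x.
  rewrite -[ltRHS]lnK ?posrE ?divr_gt0// expR_gt1Dx//.
  rewrite ln_eq0 ?divr_gt0//; apply: contra xy => /eqP yx.
  by rewrite -(mul1r x) -yx divfK// gt_eqF.
rewrite ln_div ?posrE// -(ltr_pM2r x0) divfK ?gt_eqF//.
by nra.
Qed.

Lemma xln_div x m : 0 <= x -> 0 < m -> x * ln (x / m) = x * ln x - x * ln m.
Proof.
rewrite le_eqVlt => /predU1P[<- _|x0 m0]; first by rewrite !mul0r subrr.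
by rewrite ln_div ?posrE// mulrBr.
Qed.

(** The tangent inequalities at the mixture [y], taken at [p] and [q] with weights [1 - t] and [t],
    add up to the claim: their linear parts cancel. Positivity of [q] and [t] makes [y] positive
    even when [p] vanishes. *)
Lemma xln_div_convex p q m t : 0 <= p -> 0 < q -> 0 < m -> 0 < t <= 1 ->
  (p + t * (q - p)) * ln ((p + t * (q - p)) / m) <=
  p * ln (p / m) + t * (q * ln (q / m) - p * ln (p / m)).
Proof.
move=> p0 q0 m0 /andP[t0 t1]; set y := p + _.
have y0 : 0 < y.
  rewrite (_ : y = (1 - t) * p + t * q); last by rewrite /y; ring.
  by rewrite ltr_wpDl ?mulr_gt0// mulr_ge0// subr_ge0.
rewrite !xln_div//; [|exact: ltW..].
have hp := xlnx_tangent p0 y0; have hq := xlnx_tangent (ltW q0) y0.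
rewrite -subr_ge0 in hp; rewrite -subr_ge0 in hq.
have h1 : 0 <= (1 - t) * (p * ln p - (p * ln y + p - y)).
  by rewrite mulr_ge0// subr_ge0.
have h2 : 0 <= t * (q * ln q - (q * ln y + q - y)) by rewrite mulr_ge0// ltW.
rewrite -subr_ge0; move: (addr_ge0 h1 h2); congr (0 <= _).
by rewrite /y; ring.
Qed.

(** On the unit interval $x \log x$ lies between -1, by the tangent at 1, and 0. The entropy
    integrand is therefore bounded, hence integrable. *)
Lemma xln_div_bounded x m : 0 <= x <= 1 -> 0 < m ->
  `|x * ln (x / m)| <= 1 + `|ln m|.
Proof.
move=> /andP[x0 x1] m0; rewrite xln_div//.
have h := xlnx_tangent x0 (@ltr01 R); rewrite ln1 mulr0 add0r in h.
have l : x * ln x <= 0.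
  by rewrite mulr_ge0_le0// ln_le0.
rewrite (le_trans (ler_normB _ _))// lerD//.
  by rewrite ler_norml (le_trans _ h) ?(le_trans l)//; lra.
by rewrite normrM ler_piMl// ger0_norm.
Qed.

(** Nonnegativity of the Kullback-Leibler divergence: summing the tangent inequalities, the linear
    terms cancel since the total masses agree. *)
Lemma gibbs_inequality (I : finType) (p q : I -> R) :
  (forall i, 0 <= p i) -> (forall i, 0 < q i) -> \sum_i p i = \sum_i q i ->
  0 <= \sum_i (p i * ln (p i) - p i * ln (q i)).
Proof.
move=> p0 q0 pq.
apply: (@le_trans _ _ (\sum_i (p i - q i))); first by rewrite sumrB pq subrr.
by apply: ler_sum => i _; have := xlnx_tangent (p0 i) (q0 i); lra.
Qed.

(** The gaps in the tangent inequalities are nonnegative and sum to 0, so each is an equality. *)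
Lemma gibbs_equality (I : finType) (p q : I -> R) :
  (forall i, 0 <= p i) -> (forall i, 0 < q i) -> \sum_i p i = \sum_i q i ->
  \sum_i (p i * ln (p i) - p i * ln (q i)) = 0 -> forall i, p i = q i.
Proof.
move=> p0 q0 pq e i.
have : \sum_i ((p i * ln (p i) - p i * ln (q i)) - (p i - q i)) = 0.
  by rewrite sumrB e sumrB pq subrr subr0.
move/eqP; rewrite psumr_eq0; last first.
  by move=> j _; have := xlnx_tangent (p0 j) (q0 j); lra.
move=> /allP/(_ i (mem_index_enum i))/eqP h.
by apply: xlnx_tangent_eq => //; lra.
Qed.

End entropy.

(** * First variation of the energy *)

Section multilinear.
Context {R : realType} (c : nat).
Implicit Types (f d : 'I_c -> R -> R).

(** The common form of the inner sums of [G] and of [T_pos], the latter with one argument of [phi]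
    frozen. *)
Definition multilin k (phi : k.-tuple 'I_c -> R) f (x : k.-tuple R) : R :=
  \sum_(r : k.-tuple 'I_c) phi r * \prod_(a < k) f (tnth r a) (tnth x a).

(** With this left inverse of insertion at [a], the integrand of [T_pos] becomes a function on the
    whole cube, to which Fubini applies. *)
Definition delete (T : Type) n (a : 'I_n.+1) (x : n.+1.-tuple T) : n.-tuple T :=
  [tuple tnth x (lift a j) | j < n].

Lemma delete_insert_at (T : Type) n (a : 'I_n.+1) (x : T) (y : n.-tuple T) :
  delete a (@insert_at T n.+1 a x y) = y.
Proof.
apply/eq_from_tnth => j.
by rewrite tnth_mktuple (@tnth_insert_at_lift _ n.+1).
Qed.

Lemma cube_delete n (a : 'I_n.+1) (x : n.+1.-tuple R) :
  cube n.+1 x -> cube n (delete a x).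
Proof. by move=> h i; rewrite tnth_mktuple; exact: h. Qed.

Lemma prod_neq_lift n (a : 'I_n.+1) (F : 'I_n.+1 -> R) :
  \prod_(j < n.+1 | j != a) F j = \prod_(j < n) F (lift a j).
Proof.
rewrite big_mkcond (bigD1_ord a)//= eqxx mul1r.
by apply: eq_bigr => j _; rewrite eq_sym neq_lift.
Qed.

Lemma multilin_bound k (phi : k.-tuple 'I_c -> R) f (x : k.-tuple R) :
  (forall r i, `|f r (tnth x i)| <= 1) ->
  `|multilin phi f x| <= \sum_r `|phi r|.
Proof.
move=> f1; rewrite (le_trans (ler_norm_sum _ _ _))//.
apply: ler_sum => r _; rewrite normrM ler_piMr// normr_prod.
by apply: prodr_ile1 => j; rewrite normr_ge0 f1.
Qed.

(** [prod_expansion] is applied to the product attached to each colouring [r], and the errors are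
    summed with weights [phi r]. *)
Lemma multilin_expansion n (phi : n.+1.-tuple 'I_c -> R) f d t
    (x : n.+1.-tuple R) :
  (forall r i, `|f r (tnth x i)| <= 1) ->
  (forall r i, `|d r (tnth x i)| <= 1) ->
  (forall r i, `|f r (tnth x i) + t * d r (tnth x i)| <= 1) ->
  `|multilin phi (fun r u => f r u + t * d r u) x - multilin phi f x -
    t * \sum_a \sum_r d r (tnth x a) *
      multilin (fun s => phi (@insert_at _ n.+1 a r s)) f (delete a x)| <=
  (\sum_r `|phi r|) * n.+1%:R ^+ 2 * t ^+ 2.
Proof.
move=> f1 d1 fd1.
(* The derivative is regrouped by the perturbed position [a] and its colour; this is what makes
   [T_pos] appear after integration. *)
have -> : \sum_a \sum_r d r (tnth x a) *
      multilin (fun s => phi (@insert_at _ n.+1 a r s)) f (delete a x) =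
    \sum_(r : n.+1.-tuple 'I_c) phi r * \sum_a d (tnth r a) (tnth x a) *
      \prod_(j | j != a) f (tnth r j) (tnth x j).
  under [RHS]eq_bigr do rewrite mulr_sumr.
  rewrite [RHS]exchange_big; apply: eq_bigr => a _.
  rewrite (sum_insert_at a); apply: eq_bigr => r _.
  rewrite /multilin mulr_sumr; apply: eq_bigr => s _.
  rewrite mulrCA prod_neq_lift tnth_insert_at; congr (_ * (_ * _)).
  by apply: eq_bigr => j _; rewrite (@tnth_insert_at_lift _ n.+1) tnth_mktuple.
rewrite /multilin -sumrB mulr_sumr -sumrB -mulrA mulr_suml.
rewrite (le_trans (ler_norm_sum _ _ _))//; apply: ler_sum => r _.
rewrite mulrCA -!mulrBr normrM ler_wpM2l//.
exact: prod_expansion.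
Qed.

Lemma measurable_coord k (u : R -> R) (a : 'I_k) :
  measurable_fun (`[0, 1] : set R) u ->
  measurable_fun (cube k : set (k.-tuple R)) (fun x => u (tnth x a)).
Proof.
move=> mu.
have h := @measurable_comp _ _ _ (k.-tuple (measurableTypeR R)) (measurableTypeR R) R
  `[0%R, 1%R]%classic u (cube k) (@tnth k (measurableTypeR R) ^~ a).
apply: h => //.
- by move=> _ [x xc <-]; exact: xc.
- by apply: measurable_funTS; exact: measurable_tnth.
Qed.

Lemma measurable_multilin k (phi : k.-tuple 'I_c -> R) f :
  (forall r, measurable_fun (`[0, 1] : set R) (f r)) ->
  measurable_fun (cube k : set (k.-tuple R)) (multilin phi f).
Proof.
move=> mf; apply: measurable_sum => r; apply: measurable_funM => //.
by apply: measurable_prod => a _; exact: measurable_coord.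
Qed.

End multilinear.

(** * Expansion of the energy along a segment *)

Section derivative.
Context {R : realType} (c n : nat).
Implicit Types (f g d : 'I_c -> R -> R).
Local Notation leb := (@lebesgue_measure R).
Local Notation ltup := (@lebesgue_tuple R).
Local Notation I := (`[0%R, 1%R]%classic : set R).

Lemma measurable_delete (a : 'I_n.+1) :
  measurable_fun [set: n.+1.-tuple (measurableTypeR R)]
    (@delete (measurableTypeR R) n a).
Proof.
apply/measurable_fun_tnthP => i.
rewrite (_ : _ \o _ = @tnth _ (measurableTypeR R) ^~ (lift a i)).
  exact: measurable_tnth.
by apply/funext => x /=; rewrite tnth_mktuple.
Qed.

Lemma measurable_multilin_delete (a : 'I_n.+1) (phi : n.-tuple 'I_c -> R) f :
  (forall r, measurable_fun I (f r)) ->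
  measurable_fun (cube n.+1 : set (n.+1.-tuple R))
    (fun x => multilin phi f (delete a x)).
Proof.
move=> mf.
have h := @measurable_comp _ _ _ (n.+1.-tuple (measurableTypeR R))
  (n.-tuple (measurableTypeR R)) R
  (cube n) (multilin phi f) (cube n.+1) (@delete (measurableTypeR R) n a).
apply: h.
- exact: measurable_cube.
- by move=> _ [x xc <-]; exact: cube_delete.
- exact: measurable_multilin.
- by apply: measurable_funTS; exact: measurable_delete.
Qed.

Lemma norm_fractional_partition f : fractional_partition f ->
  forall r x, x \in `[0, 1] -> `|f r x| <= 1.
Proof. by move=> [_ h _] r x /(h r) /andP[? ?]; rewrite ger0_norm. Qed.

Lemma fractional_partition_mix f g t : 0 <= t <= 1 ->
  fractional_partition f -> fractional_partition g ->
  fractional_partition (fun r u => f r u + t * (g r u - f r u)).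
Proof.
move=> /andP[t0 t1] [mf f01 f1] [mg g01 g1]; split.
- move=> r; apply: measurable_funD => //; apply: measurable_funM => //.
  exact: measurable_funB.
- move=> r x xI; have /andP[fa fb] := f01 r x xI; have /andP[ga gb] := g01 r x xI.
  rewrite (_ : _ + _ = (1 - t) * f r x + t * g r x); last by ring.
  rewrite addr_ge0 ?mulr_ge0 ?subr_ge0//=.
  have : 0 <= (1 - t) * (1 - f r x) by rewrite mulr_ge0 ?subr_ge0.
  have : 0 <= t * (1 - g r x) by rewrite mulr_ge0 ?subr_ge0.
  lra.
- move=> x xI; rewrite big_split /= f1// -mulr_sumr sumrB f1// g1//.
  by rewrite subrr mulr0 addr0.
Qed.

Variables (W : n.+1.-tuple R -> R) (phi : n.+1.-tuple 'I_c -> R).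
Hypothesis iW : (ltup n.+1).-integrable (cube n.+1) (EFin \o W).

Section T_pos.
Variable f : 'I_c -> R -> R.
Hypothesis ff : fractional_partition f.
Let mf r : measurable_fun I (f r). Proof. by have [] := ff. Qed.
Let f1 := norm_fractional_partition ff.

Let phi_ (a : 'I_n.+1) r s := phi (@insert_at _ n.+1 a r s).

Lemma cube_multilin_delete_bound a r (x : n.+1.-tuple R) : cube n.+1 x ->
  `|multilin (phi_ a r) f (delete a x)| <= \sum_s `|phi_ a r s|.
Proof.
by move=> xc; apply: multilin_bound => s i; apply: f1; exact: cube_delete.
Qed.

Let F a r (x : n.+1.-tuple R) := W x * multilin (phi_ a r) f (delete a x).

Let iF a r : (ltup n.+1).-integrable (cube n.+1) (EFin \o F a r).
Proof.
apply: (integrableM_bounded _ iW).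
- exact: measurable_cube.
- exact: measurable_multilin_delete.
- by move=> x; exact: cube_multilin_delete_bound.
Qed.

Let T_posE a r x : @T_pos R c n.+1 W phi f a r x =
  \int[ltup n]_(y in cube n) F a r (@insert_at R n.+1 a x y).
Proof. by apply: eq_Rintegral => y _; rewrite /F delete_insert_at. Qed.

Lemma integrable_T_pos a r :
  leb.-integrable I (EFin \o @T_pos R c n.+1 W phi f a r).
Proof.
have := integrable_cube_section a (iF a r).
by rewrite (_ : (fun _ => _) = EFin \o @T_pos R c n.+1 W phi f a r)//;
  apply/funext => x /=; rewrite T_posE.
Qed.

(** Fubini with coordinate [a] outermost: [u] depends on that coordinate alone and leaves the inner
    integral. *)
Lemma integral_T_pos a r (u : R -> R) (M : R) : measurable_fun I u ->
  (forall x, x \in `[0, 1] -> `|u x| <= M) ->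
  \int[ltup n.+1]_(x in cube n.+1)
    (W x * (u (tnth x a) * multilin (phi_ a r) f (delete a x))) =
  \int[leb]_(x in I) (u x * @T_pos R c n.+1 W phi f a r x).
Proof.
move=> mu uM.
have iuF : (ltup n.+1).-integrable (cube n.+1)
    (EFin \o (fun x => F a r x * u (tnth x a))).
  apply: (integrableM_bounded (M := M) _ (iF a r)).
  - exact: measurable_cube.
  - exact: measurable_coord.
  - by move=> x xc; apply: uM; exact: xc.
transitivity (\int[ltup n.+1]_(x in cube n.+1) (F a r x * u (tnth x a))).
  by apply: eq_Rintegral => x _; rewrite /F; ring.
rewrite (integral_cube a iuF); apply: ae_eq_Rintegral => //.
- by apply/measurable_EFinP; exact: measurable_int (integrable_cube_section a iuF).
- apply: measurable_funM => //.
  by apply/measurable_EFinP; exact: measurable_int (integrable_T_pos a r).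
(* Pulling the scalar out of the inner integral uses integrability of the section, known only for
   almost every [x]. *)
have := ae_integrable_cube a (iF a r).
apply: (@filterS _ _ (ae_filter_ringOfSetsType leb)) => x h xI.
rewrite T_posE -RintegralZl//; last 2 first.
- exact: measurable_cube.
- exact: h.
by apply: eq_Rintegral => y _; rewrite tnth_insert_at mulrC.
Qed.

Lemma integrable_T_sum r :
  leb.-integrable I (EFin \o @T_sum R c n.+1 W phi f r).
Proof. by apply: integrable_sumr => // a; exact: integrable_T_pos. Qed.

End T_pos.

(** The pointwise expansion integrated against [W]. The constant is the pointwise one times the
    integral of the absolute value of [W], and is uniform in [t]. *)
Lemma G_expansion f g : fractional_partition f -> fractional_partition g ->
  exists2 C, 0 <= C & forall t, 0 <= t <= 1 ->
  `|@G R c n.+1 W phi (fun r u => f r u + t * (g r u - f r u)) - G W phi f -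
    t * \sum_r \int[leb]_(x in I) ((g r x - f r x) * @T_sum R c n.+1 W phi f r x)|
  <= C * t ^+ 2.
Proof.
move=> ff fg; have [mf f01 _] := ff; have [mg g01 _] := fg.
have f1 := norm_fractional_partition ff.
pose d r x := g r x - f r x.
have md r : measurable_fun I (d r) by exact: measurable_funB.
have d1 r x : x \in `[0, 1] -> `|d r x| <= 1.
  move=> xI; have := f01 r x xI; have := g01 r x xI.
  by rewrite /d ler_norml; lra.
have mI : measurable (I : set (measurableTypeR R)) by exact: measurable_itv.
have mcube := @measurable_cube R n.+1.
pose L (x : n.+1.-tuple R) := \sum_a \sum_r d r (tnth x a) *
  multilin (fun s => phi (@insert_at _ n.+1 a r s)) f (delete a x).
have iWb (u : n.+1.-tuple R -> R) (M : R) :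
    measurable_fun (cube n.+1 : set (n.+1.-tuple R)) u ->
    (forall x, cube n.+1 x -> `|u x| <= M) ->
    (ltup n.+1).-integrable (cube n.+1) (EFin \o (fun x => W x * u x)).
  by move=> mu uM; exact: (integrableM_bounded mcube iW mu uM).
have iL1 a r : (ltup n.+1).-integrable (cube n.+1)
    (EFin \o (fun x => W x * (d r (tnth x a) *
      multilin (fun s => phi (@insert_at _ n.+1 a r s)) f (delete a x)))).
  apply: (iWb _ (\sum_s `|phi (@insert_at _ n.+1 a r s)|)).
    apply: measurable_funM; first exact: measurable_coord.
    exact: measurable_multilin_delete.
  move=> x xc; rewrite normrM.
  have := cube_multilin_delete_bound ff a r xc.
  by apply: le_trans; rewrite ler_piMl//; apply: d1; exact: xc.
have iL : (ltup n.+1).-integrable (cube n.+1) (EFin \o (fun x => W x * L x)).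
  rewrite (_ : (fun x => _) = fun x => \sum_a \sum_r W x * (d r (tnth x a) *
      multilin (fun s => phi (@insert_at _ n.+1 a r s)) f (delete a x))).
    by apply: integrable_sumr => // a; apply: integrable_sumr.
  apply/funext => x; rewrite mulr_sumr; apply: eq_bigr => a _.
  by rewrite mulr_sumr.
have IL : \int[ltup n.+1]_(x in cube n.+1) (W x * L x) =
    \sum_r \int[leb]_(x in I) (d r x * @T_sum R c n.+1 W phi f r x).
  transitivity (\int[ltup n.+1]_(x in cube n.+1) \sum_a \sum_r
      W x * (d r (tnth x a) *
      multilin (fun s => phi (@insert_at _ n.+1 a r s)) f (delete a x))).
    apply: eq_Rintegral => x _; rewrite mulr_sumr; apply: eq_bigr => a _.
    by rewrite mulr_sumr.
  rewrite Rintegral_sum//; last by move=> a; exact: integrable_sumr.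
  under eq_bigr do rewrite Rintegral_sum//.
  rewrite exchange_big; apply: eq_bigr => r _ /=.
  transitivity (\int[leb]_(x in I) \sum_a (d r x * @T_pos R c n.+1 W phi f a r x)).
    rewrite Rintegral_sum//; last first.
      move=> a; have h := integrableM_bounded mI
        (integrable_T_pos ff a r) (md r) (d1 r).
      by rewrite (_ : (fun x => _) = fun x => @T_pos R c n.+1 W phi f a r x * d r x)//;
        apply/funext => x; rewrite mulrC.
    by apply: eq_bigr => a _; exact: (integral_T_pos ff a r (md r) (d1 r)).
  by apply: eq_Rintegral => x _; rewrite /T_sum mulr_sumr.
have iP u : fractional_partition u -> (ltup n.+1).-integrable (cube n.+1)
    (EFin \o (fun x => W x * multilin phi u x)).
  move=> fu; have u1 := norm_fractional_partition fu; have [mu _ _] := fu.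
  apply: (iWb _ (\sum_r `|phi r|)); first exact: measurable_multilin.
  by move=> x xc; apply: multilin_bound => r a; apply: u1; exact: xc.
pose K := (\sum_r `|phi r|) * n.+1%:R ^+ 2.
have K0 : 0 <= K by rewrite mulr_ge0 ?sqr_ge0//; apply: sumr_ge0 => r _.
have inW := integrable_norm iW.
exists (K * \int[ltup n.+1]_(x in cube n.+1) `|W x|).
  by rewrite mulr_ge0//; apply: Rintegral_ge0 => x _; exact: normr_ge0.
move=> t t01; have fft := fractional_partition_mix t01 ff fg.
have ft1 := norm_fractional_partition fft.
(* [E] is the pointwise second-order remainder, bounded by [K * t ^+ 2] on the cube. *)
pose E x := multilin phi (fun r u => f r u + t * d r u) x - multilin phi f x - t * L x.
have iD : (ltup n.+1).-integrable (cube n.+1) (EFin \o (fun x =>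
    W x * multilin phi (fun r u => f r u + t * d r u) x - W x * multilin phi f x)).
  exact: (integrableB mcube (iP _ fft) (iP _ ff)).
have iZ : (ltup n.+1).-integrable (cube n.+1) (EFin \o (fun x => t * (W x * L x))).
  exact: (integrableZl mcube t iL).
have WE : (fun x => W x * E x) = (fun x =>
    (W x * multilin phi (fun r u => f r u + t * d r u) x - W x * multilin phi f x)
    - t * (W x * L x)).
  by apply/funext => x; rewrite /E; ring.
have iE : (ltup n.+1).-integrable (cube n.+1) (EFin \o (fun x => W x * E x)).
  by rewrite WE; exact: (integrableB mcube iD iZ).
have -> : @G R c n.+1 W phi (fun r u => f r u + t * (g r u - f r u)) - G W phi f -
    t * \sum_r \int[leb]_(x in I) ((g r x - f r x) * @T_sum R c n.+1 W phi f r x) =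
    \int[ltup n.+1]_(x in cube n.+1) (W x * E x).
  rewrite -IL WE (RintegralB mcube iD iZ) (RintegralZl t mcube iL).
  by rewrite (RintegralB mcube (iP _ fft) (iP _ ff)).
rewrite (le_trans (le_normr_Rintegral _ iE))//.
rewrite mulrAC -(RintegralZl _ mcube inW).
apply: le_Rintegral => //.
- exact: integrable_norm iE.
- exact: (integrableZl mcube _ inW).
move=> x xc; rewrite normrM mulrC ler_wpM2r//.
apply: multilin_expansion => r i.
- by apply: f1; exact: xc.
- by apply: d1; exact: xc.
- by apply: ft1; exact: xc.
Qed.

End derivative.

(** * Optimizers *)

Section optimizer.
Context {R : realType} (c n : nat).
Implicit Types (f g : 'I_c -> R -> R).
Local Notation leb := (@lebesgue_measure R).
Local Notation ltup := (@lebesgue_tuple R).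
Local Notation I := (`[0%R, 1%R]%classic : set R).
Variables (mu : 'I_c -> R) (mu_gt0 : forall r, 0 < mu r).

Let mI : measurable (I : set (measurableTypeR R)).
Proof. exact: measurable_itv. Qed.

Lemma integrable_bounded_unit_itv (u : R -> R) (M : R) : measurable_fun I u ->
  (forall x, x \in `[0, 1] -> `|u x| <= M) -> leb.-integrable I (EFin \o u).
Proof.
move=> mu' uM.
have h := @measurable_bounded_integrable _ _ R leb u I mI.
apply: h => //.
- have := @lebesgue_measure_itv R `[0, 1].
  by rewrite /= lte_fin ltr01 oppr0 adde0 => ->; exact: ltry.
- exists M; split; first exact: num_real.
  by move=> x /ltW Mx y Iy; exact: le_trans (uM y Iy) Mx.
Qed.

Lemma integrable_rel_entropy f : fractional_partition f ->
  leb.-integrable I (EFin \o (fun u => \sum_(r < c) f r u * ln (f r u / mu r))).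
Proof.
move=> [mf f01 _].
apply: (@integrable_bounded_unit_itv _ (\sum_(r < c) (1 + `|ln (mu r)|))).
  apply: measurable_sum => r; apply: measurable_funM => //.
  apply: measurableT_comp; first exact: measurable_ln.
  exact: measurable_funM.
move=> x xI; rewrite (le_trans (ler_norm_sum _ _ _))//.
by apply: ler_sum => r _; apply: xln_div_bounded => //; exact: f01.
Qed.

Lemma rel_entropy_mix f g t : fractional_partition f -> fractional_partition g ->
  (forall r x, x \in `[0, 1] -> 0 < g r x) -> 0 < t <= 1 ->
  rel_entropy mu (fun r u => f r u + t * (g r u - f r u)) <=
  rel_entropy mu f + t * (rel_entropy mu g - rel_entropy mu f).
Proof.
move=> ff fg g0 /andP[t0 t1]; have [_ f01 _] := ff.
have t01 : 0 <= t <= 1 by rewrite ltW.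
have fft := fractional_partition_mix t01 ff fg.
have iF := integrable_rel_entropy ff; have ig := integrable_rel_entropy fg.
have ift := integrable_rel_entropy fft.
have iD := integrableB mI ig iF; have iZ := integrableZl mI t iD.
rewrite /rel_entropy -(RintegralB mI ig iF) -(RintegralZl t mI iD).
rewrite -(RintegralD mI iF iZ).
apply: le_Rintegral => //; first exact: (integrableD mI iF iZ).
move=> x xI; rewrite -sumrB mulr_sumr -big_split/=; apply: ler_sum => r _.
by apply: xln_div_convex; rewrite ?t0//; [have /andP[] := f01 r x xI|exact: g0].
Qed.

Variables (W : n.+1.-tuple R -> R) (phi : n.+1.-tuple 'I_c -> R) (beta : R).
Hypothesis iW : (ltup n.+1).-integrable (cube n.+1) (EFin \o W).

(** Comparing [f] with its mixture with [g] gives the inequality multiplied by [t], up to an error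
    of order $t^2$. Dividing by [t] leaves an arbitrarily small error. *)
Lemma maximizer_variation f g : @is_maximizer R c n.+1 mu phi beta W f ->
  fractional_partition g -> (forall r x, x \in `[0, 1] -> 0 < g r x) ->
  beta * \sum_r \int[leb]_(x in I) ((g r x - f r x) * @T_sum R c n.+1 W phi f r x)
  <= rel_entropy mu g - rel_entropy mu f.
Proof.
move=> [ff fmax] fg g0; have [C C0 GC] := G_expansion phi iW ff fg.
set A := \sum_r _ in GC *; apply/ler_addgt0Pr => e e0.
(* Chosen so that the error divided by [t], at most [t * (|beta| * C)], is below [e]; the added 1
   keeps the denominator positive. *)
pose t := Num.min 1 (e / (`|beta| * C + 1)).
have bC : 0 < `|beta| * C + 1 by rewrite ltr_wpDl// mulr_ge0.
have t0 : 0 < t by rewrite lt_min ltr01 divr_gt0.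
have t1 : t <= 1 by rewrite ge_min lexx.
have t01 : 0 <= t <= 1 by rewrite ltW.
have te : t * (`|beta| * C + 1) <= e by rewrite -ler_pdivlMr// ge_min lexx orbT.
have := fmax _ (fractional_partition_mix t01 ff fg); rewrite /free_energy.
have := GC t t01.
have := rel_entropy_mix ff fg g0 _ (t := t); rewrite t0 t1 => /(_ isT).
set Gt := G _ _ (fun _ _ => _); set G0 := G _ _ f; set It := rel_entropy _ _.
set Ig := rel_entropy _ g; set I0 := rel_entropy _ f => h1 h2 h3.
have h4 : beta * (t * A) - beta * (Gt - G0) <= `|beta| * (C * t ^+ 2).
  rewrite -mulrBr (le_trans (ler_norm _))// normrM ler_wpM2l// distrC.
  by rewrite (_ : _ - _ = Gt - G0 - t * A)//; ring.
rewrite -(ler_pM2l t0).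
have h5 : t * (t * (`|beta| * C + 1)) <= t * e by rewrite ler_pM2l.
nra.
Qed.

Hypothesis c_gt0 : (0 < c)%N.

Definition gibbs f r x := mu r * expR (beta * @T_sum R c n.+1 W phi f r x) /
  \sum_(s < c) mu s * expR (beta * @T_sum R c n.+1 W phi f s x).

Let Z f x := \sum_(s < c) mu s * expR (beta * @T_sum R c n.+1 W phi f s x).

Let Z_gt0 f x : 0 < Z f x.
Proof.
rewrite /Z (bigD1 (Ordinal c_gt0))//= ltr_pwDl ?mulr_gt0 ?expR_gt0//.
by apply: sumr_ge0 => s _; rewrite mulr_ge0 ?expR_ge0 ?ltW.
Qed.

Lemma gibbs_gt0 f r x : 0 < gibbs f r x.
Proof. by rewrite divr_gt0 ?Z_gt0// mulr_gt0 ?expR_gt0. Qed.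

Lemma sum_gibbs f x : \sum_r gibbs f r x = 1.
Proof. by rewrite -mulr_suml divff// gt_eqF// Z_gt0. Qed.

Lemma ln_gibbs f r x : ln (gibbs f r x) =
  ln (mu r) + beta * @T_sum R c n.+1 W phi f r x - ln (Z f x).
Proof.
rewrite ln_div ?posrE ?Z_gt0 ?mulr_gt0 ?expR_gt0// lnM ?posrE ?expR_gt0//.
by rewrite expRK.
Qed.

Lemma fractional_partition_gibbs f : fractional_partition f ->
  fractional_partition (gibbs f).
Proof.
move=> ff.
have mT r : measurable_fun I (@T_sum R c n.+1 W phi f r).
  by apply/measurable_EFinP; exact: measurable_int (integrable_T_sum phi iW ff r).
have mE r : measurable_fun I
    (fun x => mu r * expR (beta * @T_sum R c n.+1 W phi f r x)).
  apply: measurable_funM => //; apply: measurableT_comp; first exact: measurable_expR.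
  exact: measurable_funM.
split.
- move=> r; apply: measurable_funM => //.
  have mZ : measurable_fun I (Z f) by exact: measurable_sum.
  (* Since [Z] is positive, its inverse is a composition of functions known to be measurable. *)
  rewrite (_ : (fun _ => _) = fun x => expR (- ln (Z f x))).
    apply: measurableT_comp; first exact: measurable_expR.
    apply: measurableT_comp => //.
    by apply: measurableT_comp => //; exact: measurable_ln.
  by apply/funext => x; rewrite expRN lnK// posrE Z_gt0.
- move=> r x _; rewrite ltW ?gibbs_gt0//= -(sum_gibbs f x) (bigD1 r)//= lerDl.
  by apply: sumr_ge0 => s _; rewrite ltW// gibbs_gt0.
- by move=> x _; exact: sum_gibbs.
Qed.

Lemma maximizer_gibbs f : @is_maximizer R c n.+1 mu phi beta W f ->
  \forall x \ae leb, x \in `[0, 1] -> forall r, f r x = gibbs f r x.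
Proof.
move=> fmax; have [ff _] := fmax; have [mf f01 f1] := ff.
have fg := fractional_partition_gibbs ff; have [mg g01 g1] := fg.
have := maximizer_variation fmax fg (fun r x _ => gibbs_gt0 f r x).
set T := @T_sum R c n.+1 W phi f => fvar.
pose D (u : 'I_c -> R -> R) (x : R) := \sum_(r < c) u r x * ln (u r x / mu r).
pose S (x : R) := \sum_r (gibbs f r x - f r x) * T r x.
(* [K x] is the Kullback-Leibler divergence of [f] from [gibbs f] at [x]. *)
pose K (x : R) := \sum_r (f r x * ln (f r x) - f r x * ln (gibbs f r x)).
have iS1 r : leb.-integrable I (EFin \o (fun x => (gibbs f r x - f r x) * T r x)).
  rewrite (_ : (fun _ => _) = fun x => T r x * (gibbs f r x - f r x)); last first.
    by apply/funext => x; rewrite mulrC.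
  apply: (integrableM_bounded (M := 1) mI (integrable_T_sum phi iW ff r)).
    exact: (measurable_funB (mg r) (mf r)).
  move=> x xI; have := f01 r x xI; have := g01 r x xI.
  by rewrite ler_norml; lra.
have iS : leb.-integrable I (EFin \o S) by exact: integrable_sumr.
have iDf := integrable_rel_entropy ff; have iDg := integrable_rel_entropy fg.
have iD := integrableB mI iDf iDg; have iZ := integrableZl mI beta iS.
have KE x : x \in `[0, 1] -> K x = (D f x - D (gibbs f) x) + beta * S x.
  move=> xI; rewrite /D /S -sumrB mulr_sumr -big_split/=.
  (* The normalizing term drops out because both densities sum to 1. *)
  have e : \sum_r (f r x - gibbs f r x) * ln (Z f x) = 0.
    by rewrite -mulr_suml sumrB f1// g1// subrr mul0r.
  transitivity (K x - \sum_r (f r x - gibbs f r x) * ln (Z f x)).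
    by rewrite e subr0.
  rewrite /K -sumrB; apply: eq_bigr => r _.
  have /andP[fr0 _] := f01 r x xI; have gr0 := gibbs_gt0 f r x.
  rewrite !xln_div//; last exact: ltW.
  by rewrite ln_gibbs -/(T r x); ring.
have iK : leb.-integrable I (EFin \o K).
  have h := @eq_integrable _ _ R leb I mI
    (EFin \o (fun x => (D f x - D (gibbs f) x) + beta * S x)) (EFin \o K).
  apply: h; last exact: (integrableD mI iD iZ).
  by move=> x; rewrite inE => xI /=; rewrite KE.
have fgx x : x \in `[0, 1] -> \sum_r f r x = \sum_r gibbs f r x.
  by move=> xI; rewrite f1// g1.
have K_ge0 x : x \in `[0, 1] -> 0 <= K x.
  move=> xI; apply: gibbs_inequality => [r|r|]; last exact: fgx.
  - by have /andP[] := f01 r x xI.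
  - exact: gibbs_gt0.
(* By [KE] the integral is the entropy of [f] minus that of [gibbs f] plus [beta] times the first
   variation, which [fvar] bounds by 0. *)
have K_le0 : \int[leb]_(x in I) K x <= 0.
  rewrite (_ : Rintegral _ _ _ =
      \int[leb]_(x in I) ((D f x - D (gibbs f) x) + beta * S x)); last first.
    by apply: eq_Rintegral => x /[!inE] xI; rewrite KE.
  rewrite (RintegralD mI iD iZ) (RintegralB mI iDf iDg) (RintegralZl beta mI iS).
  rewrite (Rintegral_sum mI _ iS1) -/(rel_entropy mu f) -/(rel_entropy mu (gibbs f)).
  by move: fvar; lra.
have := Rintegral_le0_ae_eq0 mI iK K_ge0 K_le0.
apply: (@filterS _ _ (ae_filter_ringOfSetsType leb)) => x h xI.
apply: (@gibbs_equality _ _ (f ^~ x) (gibbs f ^~ x)) => [r|r||].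
- by have /andP[] := f01 r x xI.
- exact: gibbs_gt0.
- exact: fgx.
- exact: h.
Qed.

End optimizer.

(** * Constant optimizers and symmetry breaking *)

Section symmetry_breaking.
Context {R : realType} (c n : nat).
Implicit Types (f g : 'I_c -> R -> R).
Local Notation leb := (@lebesgue_measure R).
Local Notation ltup := (@lebesgue_tuple R).
Local Notation I := (`[0%R, 1%R]%classic : set R).

(** The permutation sends 0 to [m] and keeps the other positions in order, so symmetry of [W] can
    move the distinguished variable to the front. *)
Lemma insert_at_perm (T : Type) (m : 'I_n.+1) (x : T) (y : n.-tuple T) :
  [tuple tnth (@insert_at T n.+1 m x y) (lift_perm ord0 m 1%g i) | i < n.+1] =
  @insert_at T n.+1 0 x y.
Proof.
apply/eq_from_tnth => i; rewrite tnth_mktuple.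
case: (unliftP ord0 i) => [j ->|->].
  rewrite lift_perm_lift perm1 (@tnth_insert_at_lift _ n.+1).
  by rewrite (@tnth_insert_at_lift _ n.+1 ord0).
by rewrite lift_perm_id tnth_insert_at (@tnth_insert_at _ n.+1 ord0).
Qed.

Lemma ae_unit_itv_ex (P : R -> Prop) :
  (\forall x \ae leb, x \in `[0, 1] -> P x) -> exists2 x, x \in `[0, 1] & P x.
Proof.
move=> [N [mN N0 sub]]; apply: contrapT => nP.
have IN : I `<=` N.
  by move=> x xI; apply: sub => /= h; apply: nP; exists x => //; exact: h.
have := @lebesgue_measure_itv R `[0, 1].
rewrite /= lte_fin ltr01 oppr0 adde0 => I1.
have mI : measurable (I : set (measurableTypeR R)) by exact: measurable_itv.
have := subset_measure0 mI mN IN N0.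
by move=> h; move: I1; rewrite [X in X = _]h => /eqP; rewrite eq_sym onee_eq0.
Qed.

Variables (W : n.+1.-tuple R -> R).
Hypothesis W_sym : symmetric_L1 W.

Let iW : (ltup n.+1).-integrable (cube n.+1) (EFin \o W).
Proof. by case: W_sym. Qed.

(** Symmetry of [W] is given only almost everywhere on the cube. It passes to almost every section,
    hence to the integrals of those sections. *)
Lemma ae_degree (m : 'I_n.+1) : \forall x \ae leb, x \in `[0, 1] ->
  \int[ltup n]_(y in cube n) W (@insert_at R n.+1 m x y) = @degree R n.+1 W x.
Proof.
have [_ /(_ (lift_perm ord0 m 1%g)) Ws] := W_sym.
have := @ae_insert _ (measurableTypeR R) R leb n m _ Ws.
move=> /ae_xsection; apply: (@filterS3 _ _ (ae_filter_ringOfSetsType leb) _ _ _ _ _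
  (ae_integrable_cube m iW) (ae_integrable_cube ord0 iW)) => x im i0 h xI.
apply: ae_eq_Rintegral.
- exact: measurable_cube.
- by apply/measurable_EFinP; exact: measurable_int (im xI).
- by apply/measurable_EFinP; exact: measurable_int (i0 xI).
apply: (@filterS _ _ (ae_filter_ringOfSetsType (ltup n))) h => y + yc.
by rewrite insert_at_perm => <- //; exact/cube_insert.
Qed.

Variable phi : n.+1.-tuple 'I_c -> R.

(** At almost every [y] all coordinates lie where [f] equals [p], so the sum over colours is a
    constant factor. What remains of each integral is the degree, whatever the position. *)
Lemma ae_T_sum_constant f (p : 'I_c -> R) : fractional_partition f ->
  (\forall x \ae leb, x \in `[0, 1] -> (fun r => f r x) = p) ->
  \forall x \ae leb, x \in `[0, 1] -> forall r,
    @T_sum R c n.+1 W phi f r x = @degree R n.+1 W x * @Gamma R c n.+1 phi r p.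
Proof.
move=> ff fp; have [mf _ _] := ff.
have fpn := @ae_tuple_measure _ (measurableTypeR R) R leb _ n fp.
have Tm (m : 'I_n.+1) : \forall x \ae leb, x \in `[0, 1] -> forall r,
    @T_pos R c n.+1 W phi f m r x = @degree R n.+1 W x *
    \sum_(s : n.-tuple 'I_c) phi (@insert_at _ n.+1 m r s) * \prod_(a < n) p (tnth s a).
  apply: (@filterS2 _ _ (ae_filter_ringOfSetsType leb) _ _ _ _
    (ae_integrable_cube m iW) (ae_degree m)) => x im h xI r.
  rewrite -h// -RintegralZr//; last 2 first.
  - exact: measurable_cube.
  - exact: im.
  have mW : measurable_fun (cube n : set (n.-tuple (measurableTypeR R)))
      (fun y => W (@insert_at R n.+1 m x y)).
    by apply/measurable_EFinP; exact: measurable_int (im xI).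
  apply: ae_eq_Rintegral.
  - exact: measurable_cube.
  - apply: measurable_funM => //.
    exact: (measurable_multilin (fun s => phi (@insert_at _ n.+1 m r s)) mf).
  - exact: measurable_funM.
  apply: (@filterS _ _ (ae_filter_ringOfSetsType (ltup n))) fpn => y fy yc.
  congr (_ * _); apply: eq_bigr => s _; congr (_ * _); apply: eq_bigr => a _.
  by have /(congr1 (fun q => q (tnth s a))) := fy a (yc a).
have := @filter_forall _ _ _ _ (ae_filter_ringOfSetsType leb) Tm.
apply: (@filterS _ _ (ae_filter_ringOfSetsType leb)) => x h xI r.
by rewrite /T_sum /Gamma mulr_sumr; apply: eq_bigr => m _; rewrite h.
Qed.

Variables (mu : 'I_c -> R) (beta : R).
Hypotheses (mu_gt0 : forall r, 0 < mu r) (mu_sum1 : \sum_r mu r = 1).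
Hypothesis c_gt0 : (0 < c)%N.

Lemma maximizer_not_ae_constant f :
  (exists r s, @Gamma R c n.+1 phi r mu <> @Gamma R c n.+1 phi s mu) ->
  beta <> 0 -> ~ ae_constant (@degree R n.+1 W) ->
  @is_maximizer R c n.+1 mu phi beta W f -> ~ ae_constant (fun x r => f r x).
Proof.
move=> [r [s Grs]] /eqP beta0 degW fmax [p fp].
have [ff _] := fmax; pose Ga := @Gamma R c n.+1 phi ^~ p.
pose w x q := mu q * expR (beta * (@degree R n.+1 W x * Ga q)).
have key : \forall x \ae leb, x \in `[0, 1] ->
    forall q, p q = w x q / \sum_q' w x q'.
  apply: (@filterS3 _ _ (ae_filter_ringOfSetsType leb) _ _ _ _ _ fp
    (ae_T_sum_constant ff fp) (maximizer_gibbs mu_gt0 iW c_gt0 fmax)).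
  move=> x fx Tx gx xI q.
  rewrite -(fx xI) gx// /gibbs Tx//; congr (_ / _).
  by apply: eq_bigr => q' _; rewrite Tx.
have w0 x q : 0 < w x q by rewrite mulr_gt0 ?expR_gt0.
have sw0 x : 0 < \sum_q w x q.
  rewrite (bigD1 (Ordinal c_gt0))//= ltr_pwDl//.
  by apply: sumr_ge0 => q _; exact: ltW.
have lnw x q : ln (w x q) = ln (mu q) + beta * (@degree R n.+1 W x * Ga q).
  by rewrite lnM ?posrE ?expR_gt0// expRK.
have Ga_eq q q' : Ga q = Ga q'.
  apply: contrapT => /eqP; rewrite -subr_eq0 => Gqq'; apply: degW.
  (* Taking logarithms in [key] for [q] and [q'] and subtracting eliminates the normalizing sum.
     This is the resulting linear equation solved for the degree. *)
  exists (((ln (p q) - ln (mu q)) - (ln (p q') - ln (mu q'))) /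
          (beta * (Ga q - Ga q'))).
  apply: (@filterS _ _ (ae_filter_ringOfSetsType leb)) key => x px xI.
  rewrite !px// !ln_div ?posrE// !lnw; field.
  by rewrite Gqq' beta0.
suff pmu : p = mu by apply: Grs; move: (Ga_eq r s); rewrite /Ga pmu.
(* As [p] does not depend on [x], one point suffices: the equal exponential factors cancel there,
   leaving [mu], which sums to 1. *)
have [x xI px] := ae_unit_itv_ex key.
apply/funext => q; rewrite px /w.
under eq_bigr do rewrite (Ga_eq _ q).
by rewrite -mulr_suml mu_sum1 mul1r mulfK// gt_eqF// expR_gt0.
Qed.

End symmetry_breaking.

Theorem proposition2p3 (R : realType) (c v : nat) (c_ge2 : (2 <= c)%N)
    (v_ge2 : (2 <= v)%N)
    (mu : 'I_c -> R) (mu_gt0 : forall r, 0 < mu r)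
    (mu_sum1 : \sum_(r < c) mu r = 1)
    (phi : v.-tuple 'I_c -> R) (beta : R)
    (Q : forall n : nat, v.-tuple 'I_n -> R)
    (Q_sym : forall n, (0 < n)%N -> symmetric_tensor (Q n))
    (Q_diag : forall n, (0 < n)%N -> zero_diagonal (Q n))
    (W : v.-tuple R -> R) (W_sym : symmetric_L1 W)
    (Q_cvg : cut_norm_star (fun x => tensor_kernel (Q n) x - W x)
               @[n --> \oo] --> 0%E) :
  (forall f : 'I_c -> R -> R, is_maximizer mu phi beta W f ->
     forall r : 'I_c, \forall x \ae (@lebesgue_measure R), x \in `[0, 1] ->
       f r x = mu r * expR (beta * T_sum W phi f r x) /
               \sum_(s < c) mu s * expR (beta * T_sum W phi f s x)) /\
  ((exists r s : 'I_c, Gamma phi r mu <> Gamma phi s mu) ->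
   beta <> 0 ->
   ~ ae_constant (degree W) ->
   forall f : 'I_c -> R -> R, is_maximizer mu phi beta W f ->
     ~ ae_constant (fun x (r : 'I_c) => f r x)).
Proof.
(* Writing [v] as [n.+1] makes [v.-1] compute to [n], the form in which the preceding lemmas are
   stated. *)
case: v v_ge2 phi Q Q_sym Q_diag W W_sym Q_cvg => [//|n] _ phi Q _ _ W W_sym _.
have c_gt0 : (0 < c)%N by exact: ltnW.
split.
  move=> f fmax r.
  have := maximizer_gibbs mu_gt0 (proj1 W_sym) c_gt0 fmax.
  by apply: (@filterS _ _ (ae_filter_ringOfSetsType _)) => x h xI; exact: h.
move=> Grs beta0 degW f fmax.
exact: (maximizer_not_ae_constant W_sym mu_gt0 mu_sum1 c_gt0 Grs beta0 degW fmax).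
Qed.
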